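(* Let $b\in\mathbb{N}$, $b\ge 1$, and $n=\frac{2^b}{2}+b$. Then a DBN with visible layer of width $n$ and $m=\frac{2^n}{2(n-b)}$ hidden layers, each of width $n$, is a universal approximator of distributions on $\{0,1\}^n$: for every probability distribution $p$ on $\{0,1\}^n$ and every $\varepsilon>0$ there exist parameters of the DBN whose visible marginal distribution $q$ satisfies $D(p\,\|\,q)<\varepsilon$.
   Context: A Deep Belief Network (DBN) with layers $h^0,h^1,\dots,h^m$, each $h^i\in\{0,1\}^n$ (here $h^0$ is the visible layer and $h^1,\dots,h^m$ are the hidden layers), has parameters: for the top two layers, $W\in\mathbb{R}^{n\times n}$, $B,C\in\mathbb{R}^n$; for each $i\in\{0,\dots,m-2\}$, a matrix $W^i\in\mathbb{R}^{n\times n}$ and offset vector $c^i\in\mathbb{R}^n$. Its joint distribution is $P(h^0,\dots,h^m)=P(h^{m-1},h^m)\prod_{i=0}^{m-2}P(h^i\mid h^{i+1})$, where $P(h^{m-1},h^m)=\frac{1}{Z}\exp\big((h^m)^TWh^{m-1}+B\cdot h^{m-1}+C\cdot h^m\big)$ (a Restricted Boltzmann Machine) and $P(h^i\mid h^{i+1})=\prod_{j=1}^n P(h^i_j\mid h^{i+1})$ with $P(h^i_j=1\mid h^{i+1})=\sigma\big(\sum_k W^i_{jk}h^{i+1}_k+c^i_j\big)$, $\sigma(x)=1/(1+e^{-x})$. The visible marginal distribution is $q(h^0)=\sum_{h^1,\dots,h^m}P(h^0,\dots,h^m)$. $D(p\|q)$ is the Kullback–Leibler divergence. *)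

(* Defs.v *)
From HB Require Import structures.
From mathcomp Require Import all_boot all_order all_algebra.
From mathcomp Require Import all_classical all_reals.
From mathcomp Require Import all_analysis.
Set Implicit Arguments. Unset Strict Implicit. Unset Printing Implicit Defensive.
Import Order.TTheory GRing.Theory Num.Theory.
Local Open Scope ring_scope.

Definition bits (n : nat) := {ffun 'I_n -> bool}.

Section DBN.
Variable R : realType.

Definition b2R (x : bool) : R := if x then 1 else 0.

Definition sigmoid (x : R) : R := 1 / (1 + expR (- x)).

Definition rbm_energy n (W : 'M[R]_n) (B C : 'I_n -> R) (hlow htop : bits n) : R :=
  \sum_(j < n) \sum_(k < n) b2R (htop j) * W j k * b2R (hlow k)
  + \sum_(k < n) B k * b2R (hlow k) + \sum_(j < n) C j * b2R (htop j).

Definition rbm_joint n (W : 'M[R]_n) (B C : 'I_n -> R) (hlow htop : bits n) : R :=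
  expR (rbm_energy W B C hlow htop) /
  \sum_(u : bits n) \sum_(v : bits n) expR (rbm_energy W B C u v).

Definition sbn_cond n (Wi : 'M[R]_n) (ci : 'I_n -> R) (hi hnext : bits n) : R :=
  \prod_(j < n)
    (let s := sigmoid (\sum_(k < n) Wi j k * b2R (hnext k) + ci j) in
     if hi j then s else 1 - s).

Definition dbn_joint n m (W : 'M[R]_n) (B C : 'I_n -> R)
    (Ws : nat -> 'M[R]_n) (cs : nat -> 'I_n -> R) (hs : {ffun 'I_m.+1 -> bits n}) : R :=
  rbm_joint W B C (hs (inord m.-1)) (hs (inord m)) *
  \prod_(i < m.-1) sbn_cond (Ws i) (cs i) (hs (inord i)) (hs (inord i.+1)).

Definition dbn_marginal n m (W : 'M[R]_n) (B C : 'I_n -> R)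
    (Ws : nat -> 'M[R]_n) (cs : nat -> 'I_n -> R) (v : bits n) : R :=
  \sum_(hs : {ffun 'I_m.+1 -> bits n} | hs ord0 == v) dbn_joint W B C Ws cs hs.

Definition is_prob_distr n (p : bits n -> R) : Prop :=
  (forall x, 0 <= p x) /\ \sum_(x : bits n) p x = 1.

Definition KL n (p q : bits n -> R) : \bar R :=
  if [exists x, (0 < p x) && (q x == 0)] then +oo%E
  else (\sum_(x : bits n) (if 0 < p x then p x * ln (p x / q x) else 0))%:E.

End DBN.

(* Main.v *)
(* Write n = N + b with N = 2^(b-1), so that m = 2^N.  The cube {0,1}^n is cut
   into 2^b = 2N Gray-code paths of length m, one in each fibre {0,1}^N x {y};
   the 2^b fibres are grouped in N pairs of adjacent y, and the i-th pair uses
   the Gray code with coordinates shifted cyclically by i, so that at each time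
   distinct pairs flip distinct coordinates.  The top RBM distributes the mass
   over the starting points of the paths, one hidden unit setting the weights of
   one pair; each directed layer then moves a prescribed part of the mass one
   step further along every path, which is possible because a single sigmoid
   unit can realise arbitrary activation probabilities on one edge of the cube
   while copying its bit everywhere else.  All this holds in the limit of large
   weights, and the contribution of one configuration of the hidden layers
   h^1, ..., h^(m-1) per visible vector already bounds the visible marginal from
   below by almost p, which bounds the divergence. *)

Require Import Defs.
From HB Require Import structures.
From mathcomp Require Import all_boot all_order all_algebra.
From mathcomp Require Import all_classical all_reals.
From mathcomp Require Import all_analysis.
From mathcomp Require Import zify ring lra.
Set Implicit Arguments. Unset Strict Implicit. Unset Printing Implicit Defensive.
Import Order.TTheory GRing.Theory Num.Theory.
Import numFieldNormedType.Exports.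
Local Open Scope classical_set_scope.
Local Open Scope ring_scope.

(** * Bit vectors and the reflected Gray code *)

Definition flip n (j : 'I_n) (x : bits n) : bits n := [ffun i => (i == j) (+) x i].

Definition bcons n (c : bool) (x : bits n) : bits n.+1 :=
  [ffun j => if unlift ord0 j is Some k then x k else c].

Lemma bcons0 n c (x : bits n) : bcons c x ord0 = c.
Proof. by rewrite ffunE unlift_none. Qed.

Lemma bcons_lift n c (x : bits n) k : bcons c x (lift ord0 k) = x k.
Proof. by rewrite ffunE liftK. Qed.

Lemma bcons_inj n c : injective (@bcons n c).
Proof. by move=> x y e; apply/ffunP=> k; rewrite -(bcons_lift c x) e bcons_lift. Qed.

Lemma flip_bcons n c j (x : bits n) : flip (lift ord0 j) (bcons c x) = bcons c (flip j x).
Proof.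
apply/ffunP=> i; case: (unliftP ord0 i) => [k|] ->; last by rewrite ffunE !bcons0.
by rewrite ffunE !bcons_lift ffunE (inj_eq lift_inj).
Qed.

Lemma flipK n (j : 'I_n) : involutive (flip j).
Proof. by move=> x; apply/ffunP=> i; rewrite !ffunE addbA addbb. Qed.

Lemma gray_code N : exists g : nat -> bits N,
  [/\ g 0%N = [ffun=> false],
      forall s t, (s < 2 ^ N)%N -> (t < 2 ^ N)%N -> g s = g t -> s = t &
      forall t, (t.+1 < 2 ^ N)%N -> exists j, g t.+1 = flip j (g t)].
Proof.
elim: N => [|N [g [g0 ginj gS]]].
  by exists (fun=> [ffun=> false]); split=> // -[|s] [|t].
exists (fun t => if (t < 2 ^ N)%N then bcons false (g t)
                 else bcons true (g (2 ^ N.+1 - t.+1)%N)).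
have N0 : (0 < 2 ^ N)%N by rewrite expn_gt0.
have NS : (2 ^ N.+1 = 2 ^ N + 2 ^ N)%N by rewrite expnS mul2n addnn.
split.
- rewrite N0 g0; apply/ffunP=> i; rewrite !ffunE.
  by case: unliftP => // k _; rewrite ffunE.
- move=> s t hs ht; case: ifP => sN; case: ifP => tN e.
  + by apply: ginj => //; apply: bcons_inj e.
  + by have := bcons0 false (g s); rewrite e bcons0.
  + by have := bcons0 false (g t); rewrite -e bcons0.
  + suff: (2 ^ N.+1 - s.+1 = 2 ^ N.+1 - t.+1)%N by lia.
    by apply: ginj; [lia|lia|exact: bcons_inj e].
- move=> t ht; case: ifP => [tN|tN].
    have -> : (t < 2 ^ N)%N by lia.
    have [j ->] := gS _ tN; exists (lift ord0 j).
    by rewrite flip_bcons.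
  (* At the seam the reversed copy begins with the last word of the first half, so only the leading
     bit changes. *)
  case: ifP => tN'.
    have -> : (2 ^ N.+1 - t.+2 = t)%N by lia.
    exists ord0; apply/ffunP=> i; rewrite !ffunE.
    by case: unliftP => [k|] ->.
  have e : (2 ^ N.+1 - t.+1 = (2 ^ N.+1 - t.+2).+1)%N by lia.
  have [|j ej] := gS (2 ^ N.+1 - t.+2)%N; first by lia.
  by exists (lift ord0 j); rewrite flip_bcons e ej flipK.
Qed.

(** * Pairing the fibres and building the system of paths *)

Lemma edge_pairing (I : finType) b : #|I| = (2 ^ b)%N ->
  exists (idx : bits b.+1 -> I) (mk : I -> bool -> bits b.+1),
  [/\ forall y : bits b.+1, mk (idx y) (y ord0) = y, forall i c, idx (mk i c) = i
    & forall y z : bits b.+1, (forall l, l != ord0 -> y l = z l) <-> idx y = idx z].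
Proof.
move=> cI; have cB : #|bits b| = #|I| by rewrite card_ffun card_bool card_ord cI.
(* A pair is the tail of [y] without its bit 0; [e] matches the [2 ^ b] tails with [I], so that [I]
   can later be taken with cyclic addition. *)
pose e (x : bits b) : I := enum_val (cast_ord cB (enum_rank x)).
have [e' eK e'K] : bijective e.
  apply: inj_card_bij; last by rewrite cB.
  by move=> x y /enum_val_inj /cast_ord_inj /enum_rank_inj.
pose tl (y : bits b.+1) : bits b := [ffun k => y (lift ord0 k)].
exists (e \o tl), (fun i c => bcons c (e' i)); split=> [y|i c|y z] /=.
- apply/ffunP=> i; case: (unliftP ord0 i) => [k|] ->; last by rewrite bcons0.
  by rewrite bcons_lift eK ffunE.
- rewrite -[RHS]e'K; congr e; apply/ffunP=> k.
  by rewrite ffunE bcons_lift.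
- split=> [h|/(can_inj eK) h l].
    by congr e; apply/ffunP=> k; rewrite !ffunE h.
  case: (unliftP ord0 l) => [k|] -> // _.
  by have := congr1 (fun f : bits b => f k) h; rewrite !ffunE.
Qed.

(* For every s, the states at time s split into edges of the cube in direction
   [dir], the edge i joining [state (mk i false) s] and [state (mk i true) s]. *)
Record state_system n M (Y I : finType) := StateSystem {
  state : Y -> nat -> bits n;
  edge : Y -> I;
  mk : I -> bool -> Y;
  dir : 'I_n;
  flipped : I -> nat -> 'I_n;
  zeros : pred 'I_n;
  state_bij : bijective (fun yt : Y * 'I_M => state yt.1 yt.2);
  state_step : forall y t, (t.+1 < M)%N ->
    state y t.+1 = flip (flipped (edge y) t) (state y t);
  mkK : forall y t, mk (edge y) (state y t dir) = y;
  flipped_inj : forall t, injective (flipped^~ t);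
  flipped_dir : forall i t, flipped i t != dir;
  state_edge : forall y i s t, (s < M)%N -> (t < M)%N ->
    (forall l, l != dir -> state y t l = state (mk i false) s l) <->
    edge y = i /\ t = s;
  state_start : forall v : bits n,
    (forall l, zeros l -> v l = false) <-> exists y, v = state y 0%N }.

(** A vector is a Gray block of [N.+1] bits followed by the label [y], whose bit 0 gives the
    direction [dir]. The block is shifted cyclically by the pair index; it also serves as [zeros],
    because the code starts at the zero word. The exponent of the theorem is [b.+1] here. *)
Lemma state_system_exists N b : N.+1 = (2 ^ b)%N ->
  inhabited (state_system (N.+1 + b.+1) (2 ^ N.+1) (bits b.+1) 'I_N.+1).
Proof.
move=> Nb; have [g [g0 ginj gS]] := gray_code N.+1.
have [|idx [mk [mkK idxK idxP]]] := @edge_pairing 'I_N.+1 b; first by rewrite card_ord.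
have /choice[f fP] : forall t, exists j : 'I_N.+1,
    (t.+1 < 2 ^ N.+1)%N -> g t.+1 = flip j (g t).
  move=> t; case: (ltnP t.+1 (2 ^ N.+1)) => [/gS[j ej]|_]; last by exists ord0.
  by exists j.
pose S (y : bits b.+1) t : bits (N.+1 + b.+1) :=
  [ffun l => match fintype.split l with inl j => g t (j - idx y) | inr k => y k end].
have Sl y t j : S y t (lshift b.+1 j) = g t (j - idx y).
  by rewrite ffunE; case: split_ordP => k; [move/lshift_inj->|move/eqP; rewrite eq_lrshift].
have Sr y t k : S y t (rshift N.+1 k) = y k.
  by rewrite ffunE; case: split_ordP => k'; [move/eqP; rewrite eq_rlshift|move/rshift_inj->].
(* Both paths of a pair carry the same shift, so the Gray block alone determines the time. *)
have Sinj y z s t : (s < 2 ^ N.+1)%N -> (t < 2 ^ N.+1)%N -> idx y = idx z ->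
    (forall j, S y s (lshift b.+1 j) = S z t (lshift b.+1 j)) -> s = t.
  move=> hs ht e h; apply: ginj => //; apply/ffunP=> j.
  by have := h (j + idx y); rewrite !Sl e addrK.
(* At time [t] the pair [i] flips [f t + i], added modulo [N.+1]: distinct pairs flip distinct
   coordinates. *)
constructor; exists S idx mk (rshift N.+1 ord0) (fun i t => lshift b.+1 (f t + i))
  (fun l => l \in codom (@lshift N.+1 b.+1)).
- apply: inj_card_bij => [[y s] [z t] /= e|].
    have yz : y = z.
      by apply/ffunP=> k; rewrite -(Sr y s) e Sr.
    rewrite {}yz in e *; congr pair; apply/val_inj => /=.
    by apply: (Sinj z z) => // j; rewrite e.
  rewrite card_prod !card_ffun !card_bool !card_ord -expnD.
  by rewrite addnC.
- move=> y t ht; apply/ffunP=> l; rewrite [RHS]ffunE.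
  case: (split_ordP l) => k ->.
    rewrite !Sl fP // ffunE; congr (_ (+) _).
    by rewrite eq_lshift subr_eq.
  by rewrite !Sr eq_rlshift.
- by move=> y t; rewrite Sr mkK.
- by move=> t i j /lshift_inj /addrI.
- by move=> i t; rewrite eq_lrshift.
- move=> y i s t hs ht; split=> [h|[<- ->] l].
    have e : idx y = i.
      rewrite -(idxK i false); apply/idxP => l l0.
      by have := h (rshift N.+1 l); rewrite !Sr; apply; rewrite (inj_eq (@rshift_inj _ _)).
    split=> //; apply: (Sinj y (mk i false)) => //; first by rewrite idxK.
    by move=> j; apply: h; rewrite eq_lrshift.
  case: (split_ordP l) => k ->; first by rewrite !Sl idxK.
  rewrite !Sr (inj_eq (@rshift_inj _ _)) => k0.
  by have [_ ->] := idxP y (mk (idx y) false); rewrite ?idxK.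
- move=> v; split=> [h|[y ->] l].
    exists [ffun k => v (rshift N.+1 k)]; apply/ffunP=> l.
    case: (split_ordP l) => k ->; last by rewrite Sr ffunE.
    by rewrite Sl g0 ffunE h // codom_f.
  by move=> /codomP[j ->]; rewrite Sl g0 ffunE.
Qed.

(** * Limits of exponentials and sigmoids as the weights grow *)

Section Limits.
Variable R : realType.
Implicit Types (a c r K : R).

Lemma cvg_sumr (I : finType) (f : I -> R -> R) (l : I -> R) :
  (forall i, f i K @[K --> +oo] --> l i) ->
  \sum_i f i K @[K --> +oo] --> \sum_i l i.
Proof. by move=> h; apply: cvg_big => //; exact: add_continuous. Qed.

Lemma cvg_prodr (I : finType) (f : I -> R -> R) (l : I -> R) :
  (forall i, f i K @[K --> +oo] --> l i) ->
  \prod_i f i K @[K --> +oo] --> \prod_i l i.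
Proof. by move=> h; apply: cvg_big => //; exact: mul_continuous. Qed.

Lemma cvg_expR_affine a c : a < 0 -> expR (K * a + c) @[K --> +oo] --> (0 : R).
Proof.
move=> a0; rewrite -[X in _ --> X](mul0r (expR c)).
have -> : (fun K => expR (K * a + c)) = (fun K => expR (- (K * - a)) * expR c).
  by apply/funext => K; rewrite expRD mulrN opprK.
apply: cvgMr_tmp; apply: (cvg_comp (fun K => K * - a) (fun x => expR (- x)) _ (@cvgr_expR R)).
by apply: (gt0_cvgMly _ (f := id)); rewrite ?oppr_gt0 //; exact: cvg_id.
Qed.

Lemma sigmoidN a : sigmoid (- a) = 1 - sigmoid a.
Proof.
rewrite /sigmoid opprK expRN; have := expR_gt0 a => ?.
by field; rewrite !lt0r_neq0 //; lra.
Qed.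

Lemma sigmoid01 a : 0 <= sigmoid a <= 1.
Proof.
rewrite /sigmoid; have := expR_gt0 (- a) => ?.
by rewrite div1r invr_ge0 invf_le1; lra.
Qed.

Lemma sigmoid_logit r : 0 < r < 1 -> sigmoid (ln (r / (1 - r))) = r.
Proof.
move=> /andP[r0 r1]; have r1' : 0 < 1 - r by lra.
rewrite /sigmoid expRN lnK ?posrE ?divr_gt0 //.
by field; rewrite !lt0r_neq0 //; lra.
Qed.

Lemma cvg_sigmoid_affine a c : 0 < a -> sigmoid (K * a + c) @[K --> +oo] --> (1 : R).
Proof.
move=> a0; have -> : (fun K => sigmoid (K * a + c)) =
    (fun K => (1 + expR (K * - a + - c))^-1).
  by apply/funext => K; rewrite /sigmoid div1r opprD mulrN.
suff : (1 + expR (K * - a + - c))^-1 @[K --> +oo] --> (1 + 0 : R)^-1.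
  by rewrite addr0 invr1.
apply: cvgV; first by rewrite addr0 oner_neq0.
apply: cvgD; first exact: cvg_cst.
by apply: cvg_expR_affine; rewrite oppr_lt0.
Qed.

Lemma cvg_sigmoid_affineN a c : a < 0 -> sigmoid (K * a + c) @[K --> +oo] --> (0 : R).
Proof.
move=> a0; have -> : (fun K => sigmoid (K * a + c)) =
    (fun K => 1 - sigmoid (K * - a + - c)).
  by apply/funext => K; rewrite -sigmoidN opprD mulrN !opprK.
rewrite -[X in _ --> X](subrr 1); apply: cvgB; first exact: cvg_cst.
by apply: cvg_sigmoid_affine; rewrite oppr_gt0.
Qed.

End Limits.

(** * Affine functions on the cube *)

Section Affine.
Variables (R : realType) (n : nat).
Implicit Types (phi psi : bits n -> R) (h u : bits n).

(** These are the functions of the adjacent layer that a unit can receive as its total input. *)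
Definition affine phi := exists (w : 'I_n -> R) (c : R),
  forall h, phi h = \sum_k w k * b2R R (h k) + c.

Lemma affine_cst (c : R) : affine (fun=> c).
Proof. by exists (fun=> 0), c => h; rewrite big1 ?add0r // => i _; rewrite mul0r. Qed.

Lemma affine_bit k : affine (fun h => b2R R (h k)).
Proof.
exists (fun l => (l == k)%:R), 0 => h; rewrite addr0 (bigD1 k) //= eqxx mul1r.
by rewrite big1 ?addr0 // => l /negPf->; rewrite mul0r.
Qed.

Lemma affineD phi psi : affine phi -> affine psi -> affine (fun h => phi h + psi h).
Proof.
move=> [w [c e]] [w' [c' e']]; exists (fun k => w k + w' k), (c + c') => h.
rewrite e e' addrACA -big_split /=; congr (_ + _).
by apply: eq_bigr => k _; rewrite mulrDl.
Qed.

Lemma affineZ (a : R) phi : affine phi -> affine (fun h => a * phi h).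
Proof.
move=> [w [c e]]; exists (fun k => a * w k), (a * c) => h.
by rewrite e mulrDr mulr_sumr; congr (_ + _); apply: eq_bigr => k _; rewrite mulrA.
Qed.

Lemma affine_sum (I : finType) (P : pred I) (phi : I -> bits n -> R) :
  (forall i, affine (phi i)) -> affine (fun h => \sum_(i | P i) phi i h).
Proof.
move=> A; pose w i := projT1 (cid (A i)); pose c i := projT1 (cid (projT2 (cid (A i)))).
have e i h : phi i h = \sum_k w i k * b2R R (h k) + c i.
  by rewrite /c; case: (cid (projT2 (cid (A i)))).
exists (fun k => \sum_(i | P i) w i k), (\sum_(i | P i) c i) => h.
under eq_bigr do rewrite e.
rewrite big_split /= exchange_big /=; congr (_ + _).
by apply: eq_bigr => k _; rewrite mulr_suml.
Qed.

Lemma affine_diff u l : affine (fun h => b2R R (h l != u l)).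
Proof.
suff -> : (fun h => b2R R (h l != u l)) =
    (fun h => (if u l then -1 else 1) * b2R R (h l) + (if u l then 1 else 0)).
  by apply: affineD; [apply: affineZ; exact: affine_bit|exact: affine_cst].
by apply/funext => h; case: (u l); case: (h l); rewrite /b2R /=; ring.
Qed.

Lemma affine_if k (c0 c1 : R) : affine (fun h => if h k then c1 else c0).
Proof.
suff -> : (fun h => if h k then c1 else c0) = (fun h => (c1 - c0) * b2R R (h k) + c0).
  by apply: affineD; [apply: affineZ; exact: affine_bit|exact: affine_cst].
by apply/funext => h; case: (h k); rewrite /b2R; ring.
Qed.

(** The Hamming distance from [h] to the edge through [u] in direction [k]. *)
Definition dist_off (k : 'I_n) u h : R := \sum_(l | l != k) b2R R (h l != u l).

Lemma affine_dist_off k u : affine (dist_off k u).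
Proof. by apply: affine_sum => l; exact: affine_diff. Qed.

Lemma b2R_ge0 x : 0 <= b2R R x.
Proof. by case: x; rewrite /b2R. Qed.

Lemma dist_off_le k u h : dist_off k u h <= n%:R.
Proof.
rewrite -[n in n%:R]card_ord -sumr_const /dist_off big_mkcond /=.
apply: ler_sum => l _; case: ifP => _; last exact: ler01.
by case: (h l != u l); rewrite /b2R ?ler01 ?lexx.
Qed.

Lemma dist_off_eq0 k u h : (forall l, l != k -> h l = u l) -> dist_off k u h = 0.
Proof. by move=> e; rewrite /dist_off big1 // => l /e->; rewrite eqxx. Qed.

Lemma dist_off_gt0 k u h : ~ (forall l, l != k -> h l = u l) -> 0 < dist_off k u h.
Proof.
move=> /existsNP[l /not_implyP[lk /eqP d]].
rewrite /dist_off (bigD1 l lk) /= d ltr_pwDl ?ltr01 // sumr_ge0 // => i _.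
exact: b2R_ge0.
Qed.

(** This yields weights that scale [phi] up by [K] and keep [psi] fixed, so [psi] decides the output
    exactly where [phi] vanishes. *)
Lemma affine_weights (phi psi : 'I_n -> bits n -> R) :
  (forall j, affine (phi j)) -> (forall j, affine (psi j)) ->
  exists (W : R -> 'M[R]_n) (c : R -> 'I_n -> R), forall K j h,
    \sum_k W K j k * b2R R (h k) + c K j = K * phi j h + psi j h.
Proof.
move=> A A'; have /choice[f /choice[g fgP]] j : exists w, exists c, forall K h,
    \sum_k (K * w.1 k + w.2 k) * b2R R (h k) + (K * c.1 + c.2) =
    K * phi j h + psi j h :> R.
  have [w [c e]] := A j; have [w' [c' e']] := A' j.
  exists (w, w'), (c, c') => K h /=; rewrite e e' mulrDr mulr_sumr addrACA -big_split /=.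
  by congr (_ + _); apply: eq_bigr => k _; ring.
exists (fun K => \matrix_(j, k) (K * (f j).1 k + (f j).2 k)).
exists (fun K j => K * (g j).1 + (g j).2) => K j h.
by under eq_bigr do rewrite mxE.
Qed.

End Affine.

(** * Sigmoid layers in the limit of large weights *)

Section Layer.
Variables (R : realType) (n : nat).

Lemma sbn_cond_ge0 (W : 'M[R]_n) c h' h : 0 <= sbn_cond W c h' h.
Proof.
apply: prodr_ge0 => j _ /=; case: (h' j); last rewrite subr_ge0.
  by have /andP[] := sigmoid01 (\sum_k W j k * b2R R (h k) + c j).
by have /andP[] := sigmoid01 (\sum_k W j k * b2R R (h k) + c j).
Qed.

Lemma sbn_cond_limit (phi psi : 'I_n -> bits n -> R) :
  (forall j, affine (phi j)) -> (forall j, affine (psi j)) ->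
  exists (W : R -> 'M[R]_n) (c : R -> 'I_n -> R), forall h' h (l : 'I_n -> R),
    (forall j, sigmoid (K * phi j h + psi j h) @[K --> +oo] --> l j) ->
    sbn_cond (W K) (c K) h' h @[K --> +oo] -->
    \prod_j (if h' j then l j else 1 - l j).
Proof.
move=> A A'; have [W [c e]] := affine_weights A A'; exists W, c => h' h l L.
apply: cvg_prodr => j /=; under eq_fun do rewrite e.
by case: (h' j); [exact: L|apply: cvgB; [exact: cvg_cst|exact: L]].
Qed.

Lemma copy_unit (j : 'I_n) : exists phi psi : bits n -> R, [/\ affine phi, affine psi &
  forall h, sigmoid (K * phi h + psi h) @[K --> +oo] --> b2R R (h j)].
Proof.
exists (fun h => if h j then 1 else -1), (fun=> 0); split; [exact: affine_if|exact: affine_cst|].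
move=> h; case: (h j); first by apply: cvg_sigmoid_affine; exact: ltr01.
by apply: cvg_sigmoid_affineN; rewrite oppr_lt0.
Qed.

(* The threshold hyperplane contains the edge of [u] in direction [k] and
   separates the rest of the cube according to the bit [j], up to the factor
   K; what happens on the edge is then decided by the bounded part [psi]. *)
Lemma edge_unit (j k : 'I_n) (u : bits n) (rho : bool -> R) :
  j != k -> (forall x, 0 < rho x < 1) ->
  exists phi psi : bits n -> R, [/\ affine phi, affine psi,
    forall h : bits n, (forall l, l != k -> h l = u l) ->
      sigmoid (K * phi h + psi h) @[K --> +oo] --> rho (h k) &
    forall h : bits n, ~ (forall l, l != k -> h l = u l) ->
      sigmoid (K * phi h + psi h) @[K --> +oo] --> b2R R (h j)].
Proof.
move=> jk rho01; pose logit r : R := ln (r / (1 - r)).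
(* Since [dist_off] is at most [n], the coefficient [n + 1] lets a disagreement at [j] fix the sign;
   otherwise the distance term fixes it, unless [h] is on the edge. *)
exists (fun h : bits n => (if u j then -1 else 1) *
          ((n%:R + 1) * b2R R (h j != u j) + -1 * dist_off R k u h)).
exists (fun h : bits n => if h k then logit (rho true) else logit (rho false)); split.
- apply/affineZ/affineD; apply: affineZ; [exact: affine_diff|exact: affine_dist_off].
- exact: affine_if.
- move=> h e; rewrite (dist_off_eq0 _ e) e // eqxx /b2R.
  under eq_fun do rewrite !(mulr0, addr0, add0r).
  by case: (h k); rewrite sigmoid_logit //; exact: cvg_cst.
- move=> h /(dist_off_gt0 R); move: (dist_off_le R k u h); move: (dist_off _ _ _ _) => d dn d0.
  case: (u j); case: (h j) => /=; rewrite /b2R.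
  + by apply: cvg_sigmoid_affine; lra.
  + by apply: cvg_sigmoid_affineN; lra.
  + by apply: cvg_sigmoid_affine; lra.
  + by apply: cvg_sigmoid_affineN; lra.
Qed.

End Layer.

(** * Layers that move mass along the paths *)

Section StateSystem.
Variables (R : realType) (n M : nat) (Y I : finType) (P : state_system n M Y I).

Lemma state_inj y t z s : (t < M)%N -> (s < M)%N ->
  state P y t = state P z s -> y = z /\ t = s.
Proof.
move=> tM sM e; have /bij_inj/(_ (y, Ordinal tM) (z, Ordinal sM) e) := state_bij P.
by case=> -> ->.
Qed.

Lemma sum_state (f : bits n -> R) : \sum_v f v = \sum_y \sum_(t < M) f (state P y t).
Proof. by rewrite (reindex _ (onW_bij _ (state_bij P))) pair_bigA. Qed.

(** By [flipped_inj] at most one pair flips [j] at time [s], so one [edge_unit] on the edge of that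
    pair suffices; without such a pair the unit copies its bit. *)
Lemma flip_unit s (r : Y -> R) j : (s < M)%N -> (forall y, 0 < r y < 1) ->
  exists phi psi : bits n -> R, [/\ affine phi, affine psi &
    forall y t, (t < M)%N ->
      sigmoid (K * phi (state P y t) + psi (state P y t)) @[K --> +oo] -->
      (if (flipped P (edge P y) s == j) && (t == s)
       then if state P y t j then 1 - r y else r y
       else b2R R (state P y t j))].
Proof.
move=> sM r01; case: (pickP (fun i => flipped P i s == j)) => [i /eqP ij|none]; last first.
  have [phi [psi [A A' L]]] := copy_unit R j.
  by exists phi, psi; split=> // y t _; rewrite none; exact: L.
pose u := state P (mk P i false) s.
(* The bit [c] in direction [dir] selects the path of the pair. Bit [j] equals [u j] on the whole
   edge and must change with probability [r]. *)
have [||phi [psi [A A' L L']]] := @edge_unit R n j (dir P) u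
    (fun c => if u j then 1 - r (mk P i c) else r (mk P i c)).
- by rewrite -ij; exact: flipped_dir.
- by move=> c; have := r01 (mk P i c); case: (u j); lra.
exists phi, psi; split=> // y t tM; rewrite -ij.
rewrite (inj_eq (@flipped_inj _ _ _ _ P s)); case: ifPn => [/andP[/eqP ei /eqP ts]|ne].
  have agree := (state_edge P y i sM tM).2 (conj ei ts).
  have := L _ agree; rewrite -[in mk P i _]ei mkK.
  by rewrite ij agree // -ij flipped_dir.
rewrite ij; apply: L' => /(state_edge P y i sM tM)[ei ts].
by rewrite ei ts !eqxx in ne.
Qed.

(** At time [s] only the unit of the flipped coordinate is random and the others copy, so each
    product reduces to one factor. Times beyond [s] are left out: the configurations followed later
    have not passed [s] when this layer acts. *)
Lemma layer_limit s (r : Y -> R) : (s.+1 < M)%N -> (forall y, 0 < r y < 1) ->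
  exists (W : R -> 'M[R]_n) (c : R -> 'I_n -> R),
  [/\ forall y t, (t < s)%N ->
        sbn_cond (W K) (c K) (state P y t) (state P y t) @[K --> +oo] --> (1 : R),
      forall y, sbn_cond (W K) (c K) (state P y s) (state P y s) @[K --> +oo] --> 1 - r y &
      forall y, sbn_cond (W K) (c K) (state P y s.+1) (state P y s) @[K --> +oo] --> r y].
Proof.
move=> sM r01; have sM' := ltnW sM.
have /choice[phi /choice[psi L]] j := flip_unit j sM' r01.
have [||W [c lim]] := @sbn_cond_limit R n phi psi; try by move=> j; case: (L j).
have {}L y t j := let: And3 _ _ h := L j in h y t.
exists W, c; split=> [y t ts|y|y].
- have := lim (state P y t) _ _ (fun j => L y t j (ltn_trans ts sM')).
  rewrite big1 // => j _; rewrite (ltn_eqF ts) andbF /b2R.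
  by case: (state P y t j); rewrite ?subr0.
- have := lim (state P y s) _ _ (fun j => L y s j sM').
  rewrite (bigD1 (flipped P (edge P y) s)) //= !eqxx /= big1 => [|j jf].
    by rewrite mulr1; case: (state P y s _); rewrite // subrr.
  by rewrite eq_sym (negPf jf) /b2R; case: (state P y s j); rewrite ?subr0.
- have := lim (state P y s.+1) _ _ (fun j => L y s j sM').
  rewrite (bigD1 (flipped P (edge P y) s)) //= !eqxx /= state_step // big1 => [|j jf].
    by rewrite mulr1 ffunE eqxx /=; case: (state P y s _); rewrite //= opprB addrC subrK.
  rewrite ffunE (negPf jf) eq_sym (negPf jf) /b2R.
  by case: (state P y s j); rewrite ?subr0.
Qed.

End StateSystem.

(** * The marginal of the top RBM *)

Section RBM.
Variables (R : realType) (n : nat).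

(** The unnormalised marginal of the lower layer. For fixed [h] the energy is linear in the top
    bits, so the sum over the top layer factors, one factor per unit. *)
Definition rbm_weight (W : 'M[R]_n) (B C : 'I_n -> R) (h : bits n) : R :=
  expR (\sum_k B k * b2R R (h k)) *
  \prod_j (1 + expR (\sum_k W j k * b2R R (h k) + C j)).

Lemma sum_expR_rbm_energy W B C h :
  \sum_u expR (rbm_energy W B C h u) = rbm_weight W B C h.
Proof.
rewrite /rbm_weight.
under [X in _ = _ * X]eq_bigr => j _.
  rewrite (_ : 1 + _ = \sum_(x : bool)
      expR (b2R R x * (\sum_k W j k * b2R R (h k) + C j))); last first.
    by rewrite big_bool /b2R mul1r mul0r expR0 addrC.
  over.
rewrite bigA_distr_bigA mulr_sumr; apply: eq_bigr => u _.
rewrite -expR_sum -expRD /rbm_energy addrAC addrC -big_split /=.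
congr (expR (_ + _)); apply: eq_bigr => j _.
by rewrite mulrDr mulr_sumr [C j * _]mulrC; congr (_ + _); apply: eq_bigr => k _; rewrite mulrA.
Qed.

Lemma sum_rbm_joint W B C h :
  \sum_u rbm_joint W B C h u = rbm_weight W B C h / \sum_v rbm_weight W B C v.
Proof.
rewrite /rbm_joint -mulr_suml sum_expR_rbm_energy; congr (_ / _).
by apply: eq_bigr => v _; rewrite sum_expR_rbm_energy.
Qed.

(** A bias [- K] on the coordinates in [zeros] suppresses every vector with a one there, as the
    remaining factors have finite limits. *)
Lemma rbm_weight_limit (phi psi : 'I_n -> bits n -> R) (zeros : pred 'I_n) :
  (forall j, affine (phi j)) -> (forall j, affine (psi j)) ->
  exists (W : R -> 'M[R]_n) (B C : R -> 'I_n -> R), forall h (l : 'I_n -> R),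
    (forall j, 1 + expR (K * phi j h + psi j h) @[K --> +oo] --> l j) ->
    rbm_weight (W K) (B K) (C K) h @[K --> +oo] -->
    (if [forall k, zeros k ==> ~~ h k] then \prod_j l j else 0).
Proof.
move=> A A'; have [W [C e]] := affine_weights A A'.
exists W, (fun K k => if zeros k then - K else 0), C => h l L.
pose a : R := \sum_(k | zeros k) b2R R (h k).
have wE K : rbm_weight (W K) (fun k => if zeros k then - K else 0) (C K) h =
    expR (K * - a + 0) * \prod_j (1 + expR (K * phi j h + psi j h)).
  rewrite /rbm_weight; congr (expR _ * _); last by apply: eq_bigr => j _; rewrite e.
  rewrite addr0 mulrN -mulNr mulr_sumr [RHS]big_mkcond; apply: eq_bigr => k _.
  by case: ifP; rewrite ?mul0r.
under eq_fun do rewrite wE.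
have LP := cvg_prodr L.
case: ifPn => [/forallP h0|/forallPn[k]].
  rewrite -[\prod_j l j]mul1r; apply: cvgM => //.
  have -> : a = 0 by rewrite /a big1 // => k zk; have := h0 k; rewrite zk /=; case: (h k).
  by under eq_fun do rewrite oppr0 mulr0 addr0 expR0; exact: cvg_cst.
rewrite negb_imply negbK => /andP[zk hk].
have a0 : - a < 0.
  rewrite oppr_lt0 /a (bigD1 k zk) /= hk /b2R.
  by rewrite ltr_pwDl ?ltr01 // sumr_ge0 // => i _; case: (h i).
have : expR (K * - a + 0) * \prod_j (1 + expR (K * phi j h + psi j h))
    @[K --> +oo] --> 0 * \prod_j l j by apply: cvgM => //; exact: cvg_expR_affine.
by rewrite mul0r.
Qed.

Variables (M : nat) (Y I : finType) (P : state_system n M Y I).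

(** With [phi] minus the distance to the starting edge of a pair, the factor tends to 1 off that
    edge; on it [psi = ln (Q - 1)] gives [Q], whence [1 < Q]. The coordinate flipped at time 0
    assigns the pairs to distinct units. *)
Lemma weight_unit j (Q : Y -> R) : (0 < M)%N -> (forall y, 1 < Q y) ->
  exists phi psi : bits n -> R, [/\ affine phi, affine psi &
    forall y t, (t < M)%N ->
      1 + expR (K * phi (state P y t) + psi (state P y t)) @[K --> +oo] -->
      (if (flipped P (edge P y) 0 == j) && (t == 0%N) then Q y else 1)].
Proof.
move=> M0 Q1.
have one (phi psi : bits n -> R) h : phi h < 0 ->
    1 + expR (K * phi h + psi h) @[K --> +oo] --> (1 : R).
  move=> ph; rewrite -[X in _ --> X]addr0; apply: cvgD; first exact: cvg_cst.
  exact: cvg_expR_affine.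
case: (pickP (fun i => flipped P i 0 == j)) => [i /eqP ij|none]; last first.
  exists (fun=> -1), (fun=> 0); split=> [||y t _]; try exact: affine_cst.
  by rewrite none; apply: (one (fun=> -1) (fun=> 0) (state P y t)); rewrite ltrN10.
pose u := state P (mk P i false) 0.
exists (fun h : bits n => -1 * dist_off R (dir P) u h).
exists (fun h : bits n => if h (dir P) then ln (Q (mk P i true) - 1)
                          else ln (Q (mk P i false) - 1)).
split=> [||y t tM].
- by apply: affineZ; exact: affine_dist_off.
- exact: affine_if.
rewrite -ij (inj_eq (@flipped_inj _ _ _ _ P 0%N)).
have [/andP[/eqP ei /eqP ts]|ne] := boolP ((edge P y == i) && (t == 0%N)).
  have agree := (state_edge P y i M0 tM).2 (conj ei ts).
  rewrite (dist_off_eq0 _ agree).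
  set E := (if _ then _ else _).
  have -> : E = ln (Q y - 1).
    rewrite -[in RHS](mkK P y t) ei /E; by case: (state P y t _).
  under eq_fun do rewrite !mulr0 add0r.
  by rewrite lnK ?posrE ?subr_gt0 // addrC subrK; exact: cvg_cst.
apply: (one (fun h => -1 * dist_off R (dir P) u h)
  (fun h : bits n => if h (dir P) then ln (Q (mk P i true) - 1) else ln (Q (mk P i false) - 1))).
rewrite mulN1r oppr_lt0; apply: dist_off_gt0 => /(state_edge P y i M0 tM)[ei ts].
by rewrite ei ts !eqxx in ne.
Qed.

Lemma rbm_limit (Q : Y -> R) : (0 < M)%N -> (forall y, 0 < Q y) -> \sum_y Q y = 1 ->
  exists (W : R -> 'M[R]_n) (B C : R -> 'I_n -> R), forall y,
    \sum_u rbm_joint (W K) (B K) (C K) (state P y 0) u @[K --> +oo] --> Q y.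
Proof.
(* Normalisation cancels a common factor; this [c] makes [c * Q y] at least [1 + Q y], as
   [weight_unit] needs a value above 1. *)
move=> M0 Q0 Q1; pose c := 1 + \sum_y (Q y)^-1.
have cQ y : 1 < c * Q y.
  rewrite /c mulrDl mul1r (bigD1 y) //= mulrDl mulVf ?gt_eqF // addrA addrAC ltrDr.
  by rewrite ltr_wpDr ?Q0 // mulr_ge0 ?(ltW (Q0 y)) // sumr_ge0 // => z _; rewrite invr_ge0 ltW.
have c0 : 0 < c by rewrite ltr_pwDl ?ltr01 // sumr_ge0 // => z _; rewrite invr_ge0 ltW.
have /choice[phi /choice[psi L]] j := weight_unit j M0 cQ.
have [||W [B [C lim]]] := @rbm_weight_limit phi psi (zeros P); try by move=> j; case: (L j).
have {}L y t j := let: And3 _ _ h := L j in h y t.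
exists W, B, C => y.
have {}lim z t : (t < M)%N -> rbm_weight (W K) (B K) (C K) (state P z t) @[K --> +oo] -->
    (if t == 0%N then c * Q z else 0).
  move=> tM; have := lim _ _ (fun j => L z t j tM).
  case: eqP => [->|t0].
    rewrite ifT; last first.
      apply/forallP => k; apply/implyP => zk; apply/negbT.
      by move: k zk; apply/state_start; exists z.
    rewrite (bigD1 (flipped P (edge P z) 0)) //= eqxx /= big1 ?mulr1 // => j jf.
    by rewrite eq_sym (negPf jf).
  (* A state vanishing on [zeros] is a starting point, so injectivity forces time 0. *)
  rewrite ifF //; apply/negbTE/negP => /forallP h.
  have /state_start[z' e] : forall k, zeros P k -> state P z t k = false.
    by move=> k zk; have := h k; rewrite zk => /negbTE.
  by have [_ /t0] := state_inj tM M0 e.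
under eq_fun do rewrite sum_rbm_joint (sum_state P).
(* The partition function tends to [c], which undoes the scaling. *)
have sumc : \sum_z \sum_(t < M) (if t == 0%N :> nat then c * Q z else 0) = c.
  rewrite -[RHS]mulr1 -Q1 mulr_sumr; apply: eq_bigr => z _.
  by rewrite (bigD1 (Ordinal M0)) //= big1 ?addr0 // => t /negPf; rewrite -val_eqE /= => ->.
suff -> : Q y = c * Q y / \sum_z \sum_(t < M) (if t == 0%N :> nat then c * Q z else 0).
  apply: cvgM; first exact: (lim y 0%N).
  apply: cvgV; last by apply: cvg_sumr => z; apply: cvg_sumr => t; exact: lim.
  by rewrite sumc gt_eqF.
by rewrite sumc mulrAC mulfV ?mul1r // gt_eqF.
Qed.

End RBM.

(** * Lower bound on the visible marginal and choice of the parameters *)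

Lemma rbm_joint_ge0 (R : realType) n (W : 'M[R]_n) B C u v : 0 <= rbm_joint W B C u v.
Proof.
rewrite divr_ge0 ?expR_ge0 // sumr_ge0 // => x _.
by rewrite sumr_ge0 // => y _; exact: expR_ge0.
Qed.

(** All terms of the marginal are nonnegative, so only the configurations that follow [gam] below a
    free top layer are kept. *)
Lemma dbn_marginal_ge (R : realType) n M (W : 'M[R]_n) B C
    (Ws : nat -> 'M[R]_n) (cs : nat -> 'I_n -> R) (gam : nat -> bits n) :
  (\sum_u rbm_joint W B C (gam M) u) *
    \prod_(i < M) sbn_cond (Ws i) (cs i) (gam i) (gam i.+1) <=
  dbn_marginal M.+1 W B C Ws cs (gam 0%N).
Proof.
pose ext (u : bits n) : {ffun 'I_M.+2 -> bits n} :=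
  [ffun i => if i == ord_max then u else gam i].
have extE u i : (i <= M)%N -> ext u (inord i) = gam i.
  move=> iM; rewrite ffunE -val_eqE /= inordK ?ltnS; last by lia.
  by rewrite ltn_eqF.
have joint_ge0 hs : 0 <= dbn_joint (m := M.+1) W B C Ws cs hs.
  rewrite mulr_ge0 ?rbm_joint_ge0 // prodr_ge0 // => i _; exact: sbn_cond_ge0.
rewrite /dbn_marginal (bigID (fun hs : {ffun 'I_M.+2 -> bits n} => ext (hs ord_max) == hs)) /=.
rewrite ler_wpDr ?sumr_ge0 //.
rewrite (reindex_onto ext (fun hs => hs ord_max)) => [|hs /andP[_ /eqP]//].
have extmax u : ext u ord_max = u by rewrite ffunE eqxx.
have ext0 u : ext u ord0 = gam 0%N by rewrite ffunE.
under [X in _ <= X]eq_bigl => u do rewrite extmax ext0 !eqxx.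
rewrite mulr_suml; apply: ler_sum => u _; rewrite /dbn_joint.
rewrite extE // (_ : inord M.+1 = ord_max) ?extmax; last first.
  by apply/val_inj; rewrite /= inordK.
rewrite ler_wpM2l ?rbm_joint_ge0 // le_eqVlt; apply/orP; left; apply/eqP.
by apply: eq_bigr => i _; rewrite !extE // ltnW.
Qed.

(** [T k] is the mass that must travel at least to [k]. Moving on with probability [T s.+1 / T s]
    and stopping with [a t / T t] telescopes. *)
Lemma prod_stay_or_move (R : realType) (a : nat -> R) M t :
  (forall i, 0 < a i) -> (t <= M)%N ->
  let T k := \sum_(k <= i < M.+1) a i in
  T 0%N * \prod_(s < M) (if (s < t)%N then T s.+1 / T s
                         else if s == t :> nat then a t / T t else 1) = a t.
Proof.
move=> a0 tM T.
have T0 k : (k <= M)%N -> T k != 0.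
  move=> kM; rewrite /T big_ltn ?ltnS // gt_eqF // ltr_pwDl // sumr_ge0 // => i _.
  exact: ltW.
suff H k : (k <= M)%N -> T 0%N * \prod_(s < k) (if (s < t)%N then T s.+1 / T s
    else if s == t :> nat then a t / T t else 1) = if (k <= t)%N then T k else a t.
  (* Reaching [M] involves no stopping factor, but there the tail is [a M] itself. *)
  rewrite H //; case: ifP => // Mt; have -> : t = M by lia.
  by rewrite /T big_nat1.
elim: k => [|k IH] kM; first by rewrite big_ord0 mulr1.
rewrite big_ord_recr /= mulrA IH; last exact: ltnW.
case: (ltngtP k t) => kt; last by rewrite kt mulrC divfK // T0.
  by rewrite mulrC divfK // T0 // ltnW.
by rewrite mulr1.
Qed.

Lemma dbn_approximates (R : realType) n M (Y I : finType)
    (P : state_system n M.+1 Y I) (p q : bits n -> R) :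
  (forall v, 0 < p v) -> \sum_v p v = 1 -> (forall v, q v < p v) ->
  exists (W : 'M[R]_n) (B C : 'I_n -> R) (Ws : nat -> 'M[R]_n) (cs : nat -> 'I_n -> R),
    forall v, q v < dbn_marginal M.+1 W B C Ws cs v.
Proof.
move=> p0 p1 qp; pose T y k := \sum_(k <= i < M.+1) p (state P y i).
have T0 y k : (k <= M)%N -> 0 < T y k.
  move=> kM; rewrite /T big_ltn ?ltnS // ltr_pwDl // sumr_ge0 // => i _; exact: ltW.
have TS y k : (k <= M)%N -> T y k = p (state P y k) + T y k.+1.
  by move=> kM; rewrite /T big_ltn.
(* The RBM puts the whole mass [T y 0] of a path on its starting point. *)
have [//|y||W [B [C limT]]] := @rbm_limit R n _ _ _ P (T^~ 0%N); first exact: T0.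
  by rewrite -p1 (sum_state P); apply: eq_bigr => y _; rewrite /T big_mkord.
(* Sampling runs downwards, so directed layer [i] performs the step at time [M - i.+1]; indices
   [i >= M] get zero weights by default. *)
have /choice[Ws /choice[cs limL]] i : exists (W : R -> 'M[R]_n) (c : R -> 'I_n -> R),
    (i < M)%N -> forall y t, (t <= M)%N -> let s := (M - i.+1)%N in
    sbn_cond (W K) (c K) (state P y (minn s.+1 t)) (state P y (minn s t))
      @[K --> +oo] -->
    (if (s < t)%N then T y s.+1 / T y s
     else if s == t then p (state P y t) / T y t else 1).
  case: (ltnP i M) => iM; last by exists (fun=> 0), (fun=> fun=> 0).
  have sM : ((M - i.+1).+1 < M.+1)%N by lia.
  move: (M - i.+1)%N sM => s sM; have sM' : (s <= M)%N := ltnW sM.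
  have [|W' [c' [L1 L2 L3]]] := @layer_limit R n _ _ _ P s (fun y => T y s.+1 / T y s) sM.
    move=> y; rewrite divr_gt0 ?T0 //=.
    by rewrite ltr_pdivrMr ?T0 // mul1r (TS y s) // ltrDr.
  exists W', c' => _ y t tM /=; case: (ltngtP s t) => st.
  - rewrite (minn_idPl st); exact: L3.
  - rewrite (minn_idPr (leqW (ltnW st))); exact: L1.
  - rewrite -st (minn_idPr (leqnSn s)).
    suff -> : p (state P y s) / T y s = 1 - T y s.+1 / T y s by exact: L2.
    have := T0 y s sM'; rewrite TS // => sT.
    by field; rewrite gt_eqF.
(* The configuration leading to time [t] on path [y]: it is at time 0 in layer [M], advances one
   step per layer downwards, and waits once [t] is reached. *)
pose gam y t i := state P y (minn (M - i) t).
have lim y (t : 'I_M.+1) :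
    (\sum_u rbm_joint (W K) (B K) (C K) (gam y t M) u) *
      \prod_(i < M) sbn_cond (Ws i K) (cs i K) (gam y t i) (gam y t i.+1)
    @[K --> +oo] --> p (state P y t).
  have tM : (t <= M)%N by rewrite -ltnS.
  rewrite -(prod_stay_or_move (fun i => p0 (state P y i)) tM).
  (* Reversing the product turns times into layer indices. *)
  rewrite (reindex_inj rev_ord_inj) /=.
  apply: cvgM; first by rewrite /gam subnn min0n; exact: limT.
  apply: cvg_prodr => i; have := limL i (ltn_ord i) y t tM.
  by rewrite /gam /= -(subSn (ltn_ord i)) subSS.
(* There are finitely many states, so one large [K] serves them all. *)
have : \forall K \near +oo, forall yt : Y * 'I_M.+1, q (state P yt.1 yt.2) <
    dbn_marginal M.+1 (W K) (B K) (C K) (Ws^~ K) (cs^~ K) (state P yt.1 yt.2).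
  apply: filter_forall => -[y t] /=.
  apply: filterS (cvgr_gt _ (lim y t) _ (qp _)) => K /lt_le_trans; apply.
  have <- : gam y t 0%N = state P y t by rewrite /gam subn0 (minn_idPr _) // -ltnS.
  exact: (dbn_marginal_ge _ _ _ _ (Ws^~ K) (cs^~ K)).
case/filter_ex => K h; exists (W K), (B K), (C K), (Ws^~ K), (cs^~ K) => v.
by have [g _ gK] := state_bij P; have := h (g v); rewrite gK.
Qed.

(** * From pointwise bounds to the divergence, and the theorem *)

Lemma KL_le (R : realType) n (p q : bits n -> R) (k : R) :
  is_prob_distr p -> 0 < k -> (forall v, k * p v < q v) -> (KL p q <= (- ln k)%:E)%E.
Proof.
move=> [p0 p1] k0 h.
have q0 v : 0 < q v by apply: le_lt_trans (h v); rewrite mulr_ge0 // ltW.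
rewrite /KL ifF; last first.
  by apply/negbTE/negP => /existsP[v /andP[_ /eqP qv]]; have := q0 v; rewrite qv ltxx.
(* As [p] sums to 1, the bound [- ln k] is its own average under [p]; termwise it remains that
   [p v / q v] is at most [1 / k]. *)
rewrite lee_fin -[leRHS]mulr1 -p1 mulr_sumr; apply: ler_sum => v _.
case: ifP => pv; last first.
  have -> : p v = 0 by apply/eqP; rewrite eq_le p0 andbT leNgt pv.
  by rewrite mulr0.
rewrite mulrC ler_pM2r // -lnV ?posrE // ler_ln ?posrE ?divr_gt0 ?invr_gt0 //.
by rewrite ler_pdivrMr // mulrC ler_pdivlMr // mulrC ltW.
Qed.

Theorem theorem2 (R : realType) (b : nat) (hb : (1 <= b)%N) :
  let n := (2 ^ b %/ 2 + b)%N in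
  let m := (2 ^ n %/ (2 * (n - b)))%N in
  forall p : bits n -> R, is_prob_distr p ->
  forall eps : R, 0 < eps ->
  exists (W : 'M[R]_n) (B C : 'I_n -> R) (Ws : nat -> 'M[R]_n) (cs : nat -> 'I_n -> R),
    (KL p (dbn_marginal m W B C Ws cs) < eps%:E)%E.
Proof.
(* Now [b.+1] is the exponent of the statement. With [2 ^ b = N.+1] one has
   [2 * (n - b.+1) = 2 ^ b.+1], so the quotient [m] is exactly [2 ^ N.+1]. *)
case: b hb => // b _ n m.
have [N eN] : exists N, (2 ^ b)%N = N.+1.
  by exists (2 ^ b).-1; rewrite prednK // expn_gt0.
have en : n = (N.+1 + b.+1)%N by rewrite /n expnS mulKn // eN.
have em : m = (2 ^ N.+1)%N.
  rewrite /m en addnK -eN -expnS eN expnD mulnK //.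
  by rewrite expn_gt0.
rewrite em; clearbody n; move: en => {m em} ->.
move=> p pp eps eps0; have [p0 p1] := pp.
have [P] := state_system_exists (esym eN).
have [M eM] : exists M, (2 ^ N.+1)%N = M.+1.
  by exists (2 ^ N.+1).-1; rewrite prednK // expn_gt0.
rewrite eM in P *.
(* This choice gives [- ln k = eps / 2]. *)
pose k := expR (- (eps / 2)).
have k0 : 0 < k := expR_gt0 _.
have k1 : k < 1 by rewrite expR_lt1 oppr_lt0 divr_gt0.
set S := bits (N.+1 + b.+1).
have S0 : 0 < #|S|%:R :> R by rewrite ltr0n; apply/card_gt0P; exists [ffun=> false].
(* Mixing with the uniform distribution gives full support and leaves room strictly above
   [k * p]. *)
pose p' (v : S) : R := k * p v + (1 - k) / #|S|%:R.
have pp' v : k * p v < p' v by rewrite ltrDl divr_gt0 ?subr_gt0.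
have [| |W [B [C [Ws [cs h]]]]] := @dbn_approximates R _ M _ _ P p' (fun v => k * p v) _ _ pp'.
- by move=> v; apply: le_lt_trans (pp' v); rewrite mulr_ge0 // ltW.
- rewrite big_split /= -mulr_sumr p1 mulr1 sumr_const -[_ *+ _]mulr_natr divfK ?gt_eqF //.
  by rewrite addrC subrK.
exists W, B, C, Ws, cs; apply: le_lt_trans (KL_le pp k0 h) _.
by rewrite lte_fin /k expRK opprK; lra.
Qed.
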